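(* Let $(M^{2n+1},\phi,\xi,\eta,g)$ be a $(\kappa,\mu)$-almost co-Kähler manifold that admits a $\beta$-almost Ricci soliton with potential vector field $\xi$, i.e. there are functions $\beta,\lambda:M\to\mathbb{R}$ such that $\beta\,\mathcal{L}_{\xi}g+2S+2\lambda g=0$, where $S$ is the Ricci tensor of $g$. Suppose that either $\beta>0$ on all of $M$ or $\beta<0$ on all of $M$. Then $\xi$ is a geodesic vector field, and the soliton is expanding, steady or shrinking according as $\kappa$ is negative, zero or positive, respectively.
   Context: An almost contact metric structure $(\phi,\xi,\eta,g)$ on a smooth $(2n+1)$-dimensional Riemannian manifold $(M,g)$ consists of a $(1,1)$-tensor field $\phi$, a unit vector field $\xi$ (the Reeb vector field) and a $1$-form $\eta$ with $\phi^2=-I+\eta\otimes\xi$, $\eta(\xi)=1$, $\phi\xi=0$, $\eta\circ\phi=0$, and $g(\phi X,\phi Y)=g(X,Y)-\eta(X)\eta(Y)$ for all vector fields $X,Y$ (so $g(X,\xi)=\eta(X)$). Put $\Phi(X,Y)=g(X,\phi Y)$. The manifold is almost co-Kähler if both $\eta$ and $\Phi$ are closed. Put $h=\tfrac12\mathcal{L}_{\xi}\phi$, where $\mathcal{L}$ denotes the Lie derivative. An almost co-Kähler manifold is a $(\kappa,\mu)$-almost co-Kähler manifold, with $\kappa,\mu\in\mathbb{R}$, if its curvature tensor $R(X,Y)=\nabla_X\nabla_Y-\nabla_Y\nabla_X-\nabla_{[X,Y]}$ satisfies $R(X,Y)\xi=\kappa[\eta(Y)X-\eta(X)Y]+\mu[\eta(Y)hX-\eta(X)hY]$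 for all vector fields $X,Y$. A $\beta$-almost Ricci soliton $\beta\,\mathcal{L}_{V}g+2S+2\lambda g=0$ is expanding, steady or shrinking when $\lambda>0$, $\lambda=0$ or $\lambda<0$, respectively. The vector field $\xi$ is geodesic if $\nabla_\xi\xi=0$, where $\nabla$ is the Levi-Civita connection. *)

(* Defs.v *)
From mathcomp Require Import all_boot all_order all_algebra.
From mathcomp Require Import all_classical all_reals all_analysis.

Set Implicit Arguments.
Unset Strict Implicit.
Unset Printing Implicit Defensive.

Import Order.TTheory GRing.Theory Num.Theory.
Import numFieldNormedType.Exports.

Local Open Scope classical_set_scope.
Local Open Scope ring_scope.

(* Tangent vectors are row vectors of components in a chart, and linear maps
   act on them by multiplication on the right. *)

Section Smoothness.
Variables (R : realType) (V W : normedModType R).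

(* Used for open U and finite-dimensional V, where it is the usual C^k. *)
Fixpoint Ck_on (k : nat) (U : set V) (f : V -> W) : Prop :=
  match k with
  | 0 => forall x, U x -> {for x, continuous f}
  | k'.+1 => (forall x, U x -> differentiable f x) /\
             (forall v : V, Ck_on k' U (fun x => 'D_v f x))
  end.

Definition smooth_on (U : set V) (f : V -> W) : Prop :=
  forall k, Ck_on k U f.

End Smoothness.

(* A smooth manifold structure of dimension m on the topological space M.
   coord i : M -> R^m is a chart with open domain dom i and inverse param i;
   the values of coord i outside dom i, and of param i outside the image of
   dom i, are irrelevant. *)
Record smooth_manifold (R : realType) (M : topologicalType) (m : nat) :=
  SmoothManifold {
  chart : Type;
  dom : chart -> set M;
  coord : chart -> M -> 'rV[R]_m;
  param : chart -> 'rV[R]_m -> M;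
  manifold_hausdorff : hausdorff_space M;
  manifold_second_countable : @second_countable M;
  dom_open : forall i, open (dom i);
  image_open : forall i, open (coord i @` dom i);
  dom_cover : forall p, exists i, dom i p;
  coordK : forall i p, dom i p -> param i (coord i p) = p;
  coord_continuous : forall i p, dom i p -> {for p, continuous (coord i)};
  param_continuous : forall i x,
    (coord i @` dom i) x -> {for x, continuous (param i)};
  transition_smooth : forall i j,
    smooth_on (coord i @` (dom i `&` dom j)) (coord j \o param i)
}.

Section Geometry.
Variables (R : realType) (M : topologicalType) (m : nat).
Variable A : smooth_manifold R M m.

Local Notation chartA := (chart A).

(* A tensor field is the family of its components in all the charts, related on
   overlaps by the classical transformation laws; T i p is meaningful only when
   p is in dom i. *)
Definition vector_family := chartA -> M -> 'rV[R]_m.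
Definition covector_family := chartA -> M -> 'cV[R]_m.
Definition matrix_family := chartA -> M -> 'M[R]_m.

Definition transition_jacobian (i j : chartA) (p : M) : 'M[R]_m :=
  jacobian (coord j \o param i) (coord i p).

Definition smooth_in_charts (W : normedModType R) (T : chartA -> M -> W) :=
  forall i, smooth_on (coord i @` dom i) (T i \o param i).

Definition smooth_function (f : M -> R) : Prop :=
  smooth_in_charts (fun (_ : chartA) p => f p : R^o).

Definition vector_field (X : vector_family) : Prop :=
  smooth_in_charts X /\
  forall i j p, dom i p -> dom j p ->
    X j p = X i p *m transition_jacobian i j p.

Definition one_form (eta : covector_family) : Prop :=
  smooth_in_charts eta /\
  forall i j p, dom i p -> dom j p ->
    eta i p = transition_jacobian i j p *m eta j p.

Definition tensor11 (phi : matrix_family) : Prop :=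
  smooth_in_charts phi /\
  forall i j p, dom i p -> dom j p ->
    phi i p *m transition_jacobian i j p = transition_jacobian i j p *m phi j p.

Definition tensor02 (g : matrix_family) : Prop :=
  smooth_in_charts g /\
  forall i j p, dom i p -> dom j p ->
    g i p = transition_jacobian i j p *m g j p *m (transition_jacobian i j p)^T.

Definition pair1 (eta : covector_family) (i : chartA) (p : M) (u : 'rV[R]_m)
  : R^o := (u *m eta i p) 0 0.

Definition pair2 (g : matrix_family) (i : chartA) (p : M) (u v : 'rV[R]_m)
  : R^o := (u *m g i p *m v^T) 0 0.

Definition apply11 (phi : matrix_family) (X : vector_family) : vector_family :=
  fun i p => X i p *m phi i p.

(* Derivative at p, read in the chart i, in the direction with components v. *)
Definition chart_deriv (W : normedModType R) (i : chartA) (f : M -> W) (p : M)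
  (v : 'rV[R]_m) : W := 'D_v (f \o param i) (coord i p).

(* [X, Y]^k = X^j d_j Y^k - Y^j d_j X^k *)
Definition bracket (X Y : vector_family) : vector_family :=
  fun i p => chart_deriv i (Y i) p (X i p) - chart_deriv i (X i) p (Y i p).

(* (d eta)_jk = d_j eta_k - d_k eta_j *)
Definition closed1 (eta : covector_family) : Prop :=
  forall i p, dom i p -> forall u v,
    chart_deriv i (fun q => pair1 eta i q v) p u
    - chart_deriv i (fun q => pair1 eta i q u) p v = 0.

(* (d Phi)_jkl = d_j Phi_kl + d_k Phi_lj + d_l Phi_jk, for the 2-form with
   components Phi i p u v *)
Definition closed2 (Phi : chartA -> M -> 'rV[R]_m -> 'rV[R]_m -> R^o) : Prop :=
  forall i p, dom i p -> forall u v w,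
    chart_deriv i (fun q => Phi i q v w) p u
    + chart_deriv i (fun q => Phi i q w u) p v
    + chart_deriv i (fun q => Phi i q u v) p w = 0.

Definition riemannian_metric (g : matrix_family) : Prop :=
  [/\ tensor02 g,
      forall i p, dom i p -> forall u v, pair2 g i p u v = pair2 g i p v u
    & forall i p, dom i p -> forall u, u != 0 -> 0 < pair2 g i p u u].

Record affine_connection
  (nabla : vector_family -> vector_family -> vector_family) : Prop := {
  nabla_field : forall X Y, vector_field X -> vector_field Y ->
    vector_field (nabla X Y);
  nabla_linear : forall (f : M -> R) X X' Y,
    smooth_function f -> vector_field X -> vector_field X' -> vector_field Y ->
    forall i p, dom i p ->
      nabla (fun j q => f q *: X j q + X' j q) Y i p
      = f p *: nabla X Y i p + nabla X' Y i p;
  nabla_leibniz : forall (f : M -> R) X Y Y',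
    smooth_function f -> vector_field X -> vector_field Y -> vector_field Y' ->
    forall i p, dom i p ->
      nabla X (fun j q => f q *: Y j q + Y' j q) i p
      = chart_deriv i (f : M -> R^o) p (X i p) *: Y i p
        + f p *: nabla X Y i p + nabla X Y' i p
}.

Record levi_civita (g : matrix_family)
  (nabla : vector_family -> vector_family -> vector_family) : Prop := {
  lc_connection : affine_connection nabla;
  lc_torsion_free : forall X Y, vector_field X -> vector_field Y ->
    forall i p, dom i p ->
      nabla X Y i p - nabla Y X i p = bracket X Y i p;
  lc_metric : forall X Y Z,
    vector_field X -> vector_field Y -> vector_field Z ->
    forall i p, dom i p ->
      chart_deriv i (fun q => pair2 g i q (Y i q) (Z i q)) p (X i p)
      = pair2 g i p (nabla X Y i p) (Z i p)
        + pair2 g i p (Y i p) (nabla X Z i p)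
}.

Definition curvature
  (nabla : vector_family -> vector_family -> vector_family)
  (X Y Z : vector_family) : vector_family :=
  fun i p => nabla X (nabla Y Z) i p - nabla Y (nabla X Z) i p
             - nabla (bracket X Y) Z i p.

(* S(Y, Z) is the trace of the endomorphism X_p |-> (R(X, Y)Z)_p of the tangent
   space at p.  Since R(X, Y)Z is linear over smooth functions in X, the matrix B
   below exists and is unique. *)
Definition ricci_tensor
  (nabla : vector_family -> vector_family -> vector_family)
  (S : matrix_family) : Prop :=
  tensor02 S /\
  forall Y Z, vector_field Y -> vector_field Z ->
  forall i p, dom i p ->
  forall B : 'M[R]_m,
    (forall X, vector_field X -> curvature nabla X Y Z i p = X i p *m B) ->
    pair2 S i p (Y i p) (Z i p) = \tr B.

(* (L_V phi)X = [V, phi X] - phi [V, X] *)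
Definition lie11 (V : vector_family) (phi : matrix_family) (X : vector_family)
  : vector_family :=
  fun i p => bracket V (apply11 phi X) i p - apply11 phi (bracket V X) i p.

(* (L_V g)(X, Y) = V(g(X, Y)) - g([V, X], Y) - g(X, [V, Y]) *)
Definition lie02 (V : vector_family) (g : matrix_family) (X Y : vector_family)
  (i : chartA) (p : M) : R :=
  chart_deriv i (fun q => pair2 g i q (X i q) (Y i q)) p (V i p)
  - pair2 g i p (bracket V X i p) (Y i p)
  - pair2 g i p (X i p) (bracket V Y i p).

Record almost_contact_metric (phi : matrix_family) (xi : vector_family)
  (eta : covector_family) (g : matrix_family) : Prop := {
  acm_metric : riemannian_metric g;
  acm_phi : tensor11 phi;
  acm_xi : vector_field xi;
  acm_eta : one_form eta;
  acm_xi_unit : forall i p, dom i p -> pair2 g i p (xi i p) (xi i p) = 1;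
  acm_phi_sq : forall i p, dom i p -> forall u,
    u *m phi i p *m phi i p = - u + pair1 eta i p u *: xi i p;
  acm_eta_xi : forall i p, dom i p -> pair1 eta i p (xi i p) = 1;
  acm_phi_xi : forall i p, dom i p -> xi i p *m phi i p = 0;
  acm_eta_phi : forall i p, dom i p -> forall u,
    pair1 eta i p (u *m phi i p) = 0;
  acm_compat : forall i p, dom i p -> forall u v,
    pair2 g i p (u *m phi i p) (v *m phi i p)
    = pair2 g i p u v - pair1 eta i p u * pair1 eta i p v
}.

Definition fundamental_form (phi g : matrix_family) (i : chartA) (p : M)
  (u v : 'rV[R]_m) : R^o := pair2 g i p u (v *m phi i p).

Record almost_cokahler (phi : matrix_family) (xi : vector_family)
  (eta : covector_family) (g : matrix_family) : Prop := {
  ack_contact : almost_contact_metric phi xi eta g;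
  ack_eta_closed : closed1 eta;
  ack_Phi_closed : closed2 (fundamental_form phi g)
}.

Definition h_operator (phi : matrix_family) (xi X : vector_family)
  : vector_family := fun i p => 2^-1 *: lie11 xi phi X i p.

Record kappa_mu_almost_cokahler (kappa mu : R) (phi : matrix_family)
  (xi : vector_family) (eta : covector_family) (g : matrix_family)
  (nabla : vector_family -> vector_family -> vector_family) : Prop := {
  km_cokahler : almost_cokahler phi xi eta g;
  km_levi_civita : levi_civita g nabla;
  km_curvature : forall X Y, vector_field X -> vector_field Y ->
    forall i p, dom i p ->
      curvature nabla X Y xi i p
      = kappa *: (pair1 eta i p (Y i p) *: X i p
                  - pair1 eta i p (X i p) *: Y i p)
        + mu *: (pair1 eta i p (Y i p) *: h_operator phi xi X i p
                 - pair1 eta i p (X i p) *: h_operator phi xi Y i p)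
}.

Definition beta_almost_ricci_soliton (beta lambda : M -> R)
  (V : vector_family) (g S : matrix_family) : Prop :=
  forall X Y, vector_field X -> vector_field Y ->
  forall i p, dom i p ->
    beta p * lie02 V g X Y i p + 2 * pair2 S i p (X i p) (Y i p)
    + 2 * lambda p * pair2 g i p (X i p) (Y i p) = 0.

Definition geodesic_field
  (nabla : vector_family -> vector_family -> vector_family)
  (V : vector_family) : Prop :=
  forall i p, dom i p -> nabla V V i p = 0.

End Geometry.

Definition expanding (R : realType) (M : Type) (lambda : M -> R) : Prop :=
  forall p, 0 < lambda p.
Definition steady (R : realType) (M : Type) (lambda : M -> R) : Prop :=
  forall p, lambda p = 0.
Definition shrinking (R : realType) (M : Type) (lambda : M -> R) : Prop :=
  forall p, lambda p < 0.

(* Main.v *)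
Require Import Defs.
From mathcomp Require Import all_boot all_order all_algebra.
From mathcomp Require Import all_classical all_reals all_analysis.
From mathcomp Require Import lra.
(* [coord] must denote the chart maps, not the coordinates in a vector space *)
Import Defs.

Set Implicit Arguments.
Unset Strict Implicit.
Unset Printing Implicit Defensive.

Import Order.TTheory GRing.Theory Num.Theory.
Import numFieldNormedType.Exports.

Local Open Scope classical_set_scope.
Local Open Scope ring_scope.

(** The two conclusions rest on two independent pointwise facts.

    The Reeb field xi is geodesic because eta is closed and xi has unit length.
    Since eta is the metric dual of xi, the torsion-free metric connection turns
    d eta (xi, W) = 0 into g (nabla xi xi, W) = g (nabla W xi, xi), and the right
    side is half the derivative of the constant g (xi, xi) along W.  The vector
    field nabla xi xi is itself an admissible W, and this choice makes its norm
    vanish, which avoids extending arbitrary tangent vectors to vector fields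
    ([unit_closed_reeb_geodesic]).

    For lambda, the soliton equation is evaluated at the pair (xi, xi), where
    the term coming from the Lie derivative of g is zero: what remains is
    lambda = - S (xi, xi) ([soliton_lambda]).  On the other side, the nullity
    condition presents X |-> R (X, xi) xi as the endomorphism
    kappa (I - eta (x) xi) + mu h, because h xi = 0.  Its trace is 2 n kappa as
    soon as tr h = 0.  In a chart, with J the Jacobian of xi, the
    operator 2 h has matrix D_xi phi + J phi - phi J; the commutator is traceless,
    and tr (D_xi phi) is the derivative of tr phi, which vanishes identically
    because phi is skew for g ([h_operatorE], [mxtrace_h], [ricci_xi_xi]).
    Hence lambda is the constant - 2 n kappa, whose sign is opposite to that of
    kappa. *)

(** * Matrix algebra and derivatives of matrix-valued maps *)

Lemma mx_pair2_inj (R : comNzRingType) (m : nat) (B C : 'M[R]_m) :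
  (forall u v : 'rV_m, (u *m B *m v^T) 0 0 = (u *m C *m v^T) 0 0) -> B = C.
Proof.
move=> BC; apply/matrixP => a b.
have := BC (delta_mx 0 a) (delta_mx 0 b).
by rewrite trmx_delta -!rowE -!colE !mxE.
Qed.

Section MatrixCalculus.
Variables (R : realType) (V : normedModType R).

Lemma derive_entry (a b : nat) (f : V -> 'M[R]_(a, b)) (x v : V) i j :
  derivable f x v -> 'D_v (fun y => f y i j : R^o) x = ('D_v f x) i j.
Proof. by move=> /derive_mx ->; rewrite mxE. Qed.

Lemma derive_mulmx (a b c : nat) (f : V -> 'M[R]_(a, b))
  (h : V -> 'M[R]_(b, c)) (x v : V) :
  derivable f x v -> derivable h x v ->
  derivable (fun y => f y *m h y) x v /\
  'D_v (fun y => f y *m h y) x = 'D_v f x *m h x + f x *m 'D_v h x.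
Proof.
move=> df dh.
have /derivable_mxP dfe := df; have /derivable_mxP dhe := dh.
have entryE i j : (fun y => (f y *m h y) i j) =
    \sum_(k < b) ((fun y => f y i k) * (fun y => h y k j)).
  apply/funext => y; rewrite mxE fct_sumE.
  by apply: eq_bigr.
have dfh : derivable (fun y => f y *m h y) x v.
  apply/derivable_mxP => i j; rewrite entryE.
  by apply: derivable_sum => k; apply: derivableM.
split=> //; rewrite derive_mx //; apply/matrixP => i j.
rewrite !mxE entryE derive_sum; last by move=> k; apply: derivableM.
rewrite -big_split; apply: eq_bigr => k _ /=.
rewrite deriveM // !derive_mx // !mxE addrC mulrC.
by congr (_ + _); rewrite mulrC.
Qed.

Lemma derive_mxtrace (a : nat) (f : V -> 'M[R]_a) (x v : V) :
  derivable f x v -> 'D_v (fun y => \tr (f y) : R^o) x = \tr ('D_v f x).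
Proof.
move=> df; have /derivable_mxP dfe := df.
rewrite (_ : (fun y => _) = \sum_(k < a) (fun y => f y k k : R^o)); last first.
  by apply/funext => y; rewrite fct_sumE.
rewrite derive_sum //; apply: eq_bigr => k _.
by rewrite derive_entry.
Qed.

End MatrixCalculus.

(** * Derivatives of tensor components in a chart *)

Section ChartCalculus.
Variables (R : realType) (M : topologicalType) (m : nat).
Variable A : smooth_manifold R M m.
Implicit Types (i : chart A) (p : M) (v : 'rV[R]_m).

(** The image of a chart domain is open, so the identities between components,
    which hold only on the domain, can be differentiated. *)
Lemma chart_deriv_local (W : normedModType R) i (f h : M -> W) p v :
  dom i p -> (forall q, dom i q -> f q = h q) ->
  chart_deriv i f p v = chart_deriv i h p v.
Proof.
move=> ip fh; apply: near_eq_derive.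
have cp : (coord i @` dom i) (coord i p) by exists p.
near=> x.
have [q iq <-] : (coord i @` dom i) x.
  near: x; apply: open_nbhs_nbhs; split=> //; exact: image_open.
by rewrite /= coordK //; exact: fh.
Unshelve. all: by end_near. Qed.

Lemma chart_deriv_cst (W : normedModType R) i (w : W) p v :
  chart_deriv i (fun=> w) p v = 0.
Proof. exact: derive_cst. Qed.

Lemma smooth_differentiable (W : normedModType R) (T : chart A -> M -> W) i p :
  smooth_in_charts T -> dom i p -> differentiable (T i \o param i) (coord i p).
Proof. by move=> /(_ i 1%N) [dT _] ip; apply: dT; exists p. Qed.

Lemma smooth_derivable (W : normedModType R) (T : chart A -> M -> W) i p v :
  smooth_in_charts T -> dom i p -> derivable (T i \o param i) (coord i p) v.
Proof. by move=> sT ip; apply/diff_derivable/smooth_differentiable. Qed.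

Lemma chart_deriv_jacobian (X : vector_family A) i p v :
  smooth_in_charts X -> dom i p ->
  chart_deriv i (X i) p v = v *m jacobian (X i \o param i) (coord i p).
Proof. by move=> sX ip; apply/deriveEjacobian/smooth_differentiable. Qed.

Lemma chart_deriv_mulmx (a b c : nat) (S : chart A -> M -> 'M[R]_(a, b))
  (T : chart A -> M -> 'M[R]_(b, c)) i p v :
  smooth_in_charts S -> smooth_in_charts T -> dom i p ->
  chart_deriv i (fun q => S i q *m T i q) p v
  = chart_deriv i (S i) p v *m T i p + S i p *m chart_deriv i (T i) p v.
Proof.
move=> sS sT ip.
have [_ ] := derive_mulmx (smooth_derivable (v := v) sS ip)
  (smooth_derivable (v := v) sT ip).
by rewrite /= coordK.
Qed.

Lemma chart_deriv_pair1 (eta : covector_family A) (X : vector_family A) i p v :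
  smooth_in_charts eta -> smooth_in_charts X -> dom i p ->
  chart_deriv i (fun q => pair1 eta i q (X i q)) p v
  = pair1 eta i p (chart_deriv i (X i) p v)
    + (X i p *m chart_deriv i (eta i) p v) 0 0.
Proof.
move=> se sX ip; have /matrixP/(_ 0 0) := chart_deriv_mulmx v sX se ip.
rewrite mxE /pair1 => <-.
apply: (@derive_entry _ _ _ _ (fun x => X i (param i x) *m eta i (param i x))).
by have [] := derive_mulmx (smooth_derivable (v := v) sX ip)
  (smooth_derivable (v := v) se ip).
Qed.

Lemma smooth_cst (W : normedModType R) (w : W) :
  smooth_in_charts (fun (_ : chart A) (_ : M) => w).
Proof.
move=> i k; rewrite /comp; elim: k w => [|k IH] w /=.
  by move=> x _; exact: cst_continuous.
split=> [x _|v]; first exact: differentiable_cst.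
have -> : (fun x : 'rV[R]_m => 'D_v (fun _ : 'rV[R]_m => w) x) = fun=> 0.
  by apply/funext => x; exact: derive_cst.
exact: IH.
Qed.

(** The closedness of a 1-form is phrased with constant component vectors; this
    isolates the part of the derivative that falls on the form. *)
Lemma chart_deriv_pair1_cst (eta : covector_family A) i p u v :
  smooth_in_charts eta -> dom i p ->
  chart_deriv i (fun q => pair1 eta i q u) p v
  = (u *m chart_deriv i (eta i) p v) 0 0.
Proof.
move=> se ip.
rewrite (@chart_deriv_pair1 eta (fun _ _ => u)) //; last exact: smooth_cst.
by rewrite chart_deriv_cst /pair1 mul0mx mxE add0r.
Qed.

End ChartCalculus.

(** * The structure tensors and the operator h *)

Section AlmostContact.
Variables (R : realType) (M : topologicalType) (m : nat).
Variable A : smooth_manifold R M m.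
Variables (phi : matrix_family A) (xi : vector_family A).
Variables (eta : covector_family A) (g : matrix_family A).
Hypothesis acm : almost_contact_metric phi xi eta g.
Implicit Types (i : chart A) (p : M) (u v : 'rV[R]_m).

(** Compatibility with v = xi has a vanishing left side, since phi xi = 0. *)
Lemma metric_xi i p u : dom i p -> pair2 g i p u (xi i p) = pair1 eta i p u.
Proof.
move=> ip; have := acm_compat acm ip u (xi i p).
rewrite (acm_phi_xi acm ip) (acm_eta_xi acm ip) mulr1.
rewrite /pair2 trmx0 mulmx0 mxE => /esym/eqP.
by rewrite subr_eq0 => /eqP.
Qed.

(** Compatibility with v replaced by phi v, and phi^2 v expanded: the xi
    component drops out because phi u is orthogonal to xi. *)
Lemma phi_skew i p u v : dom i p ->
  pair2 g i p (u *m phi i p) v = - pair2 g i p u (v *m phi i p).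
Proof.
move=> ip; have := acm_compat acm ip u (v *m phi i p).
rewrite (acm_phi_sq acm ip) (acm_eta_phi acm ip) mulr0 subr0 => <-.
have := metric_xi (u *m phi i p) ip; rewrite (acm_eta_phi acm ip) /pair2.
rewrite linearD linearN linearZ /= mulmxDr mulmxN -scalemxAr => gxi.
by rewrite [in RHS]mxE [fun_of_matrix (_ *: _) _ _]mxE gxi mulr0 addr0 [in RHS]mxE opprK.
Qed.

(** Skewness reads phi g = - g phi^T, so phi is conjugate to - phi^T and its
    trace is its own opposite. *)
Lemma mxtrace_phi i p : dom i p -> \tr (phi i p) = 0.
Proof.
move=> ip.
have skew : phi i p *m g i p = - (g i p *m (phi i p)^T).
  apply: mx_pair2_inj => u v; have := phi_skew u v ip.
  by rewrite /pair2 trmx_mul !mulmxA mulmxN mulNmx => ->; rewrite [RHS]mxE !mulmxA.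
(* a row of the kernel of g would be a nonzero vector of zero length *)
have gu : g i p \in unitmx.
  rewrite -row_free_unit -kermx_eq0; apply/eqP/row_matrixP => k.
  rewrite row0; apply/eqP; apply: contraT => k0.
  have [_ _ /(_ i p ip _ k0)] := acm_metric acm.
  by rewrite /pair2 -row_mul mulmx_ker row0 mul0mx mxE ltxx.
have : \tr (phi i p) = - \tr (phi i p).
  rewrite -{1}(mulmxK gu (phi i p)) skew mulNmx linearN /=.
  by rewrite mxtrace_mulC mulmxA mulVmx // mul1mx mxtrace_tr.
lra.
Qed.

Definition h_matrix i p : 'M[R]_m :=
  let J := jacobian (xi i \o param i) (coord i p) in
  2^-1 *: (chart_deriv i (phi i) p (xi i p) + J *m phi i p - phi i p *m J).

(** The derivatives of X cancel between [xi, phi X] and phi [xi, X], so h is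
    tensorial. *)
Lemma h_operatorE (X : vector_family A) i p : vector_field X -> dom i p ->
  h_operator phi xi X i p = X i p *m h_matrix i p.
Proof.
move=> [sX _] ip; have [sphi _] := acm_phi acm; have [sxi _] := acm_xi acm.
rewrite /h_operator /lie11 /h_matrix /apply11 /bracket chart_deriv_mulmx //.
rewrite !(chart_deriv_jacobian _ sxi ip) -scalemxAr; congr (_ *: _).
rewrite mulmxBr mulmxDr mulmxBl !mulmxA opprB.
rewrite addrC -[X in _ + X]addrA subrKA addrCA addrA.
by congr (_ + _ - _).
Qed.

Lemma h_matrix_xi i p : dom i p -> xi i p *m h_matrix i p = 0.
Proof.
move=> ip; rewrite -(h_operatorE (acm_xi acm) ip).
rewrite /h_operator /lie11 /bracket /apply11 subrr mul0mx subr0.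
have phi_xi0 q : dom i q -> xi i q *m phi i q = 0.
  by move=> iq; rewrite (acm_phi_xi acm iq).
rewrite (phi_xi0 p ip) (chart_deriv_local _ ip phi_xi0).
have [sxi _] := acm_xi acm.
by rewrite chart_deriv_cst chart_deriv_jacobian // mul0mx subr0 scaler0.
Qed.

(** The two Jacobian terms form a commutator, and the remaining term is the
    derivative of the trace of phi, which is zero on the whole domain. *)
Lemma mxtrace_h i p : dom i p -> \tr (h_matrix i p) = 0.
Proof.
move=> ip; have [sphi _] := acm_phi acm.
rewrite /h_matrix linearZ linearB linearD /= [\tr (phi i p *m _)]mxtrace_mulC.
rewrite addrK.
have trD : \tr (chart_deriv i (phi i) p (xi i p)) = 0.
  rewrite -(derive_mxtrace (smooth_derivable (v := xi i p) sphi ip)).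
  rewrite -[LHS]/(chart_deriv i (fun q => \tr (phi i q) : R^o) p (xi i p)).
  by rewrite (chart_deriv_local _ ip (fun q iq => mxtrace_phi iq)) chart_deriv_cst.
by rewrite trD mulr0.
Qed.

End AlmostContact.

(** * The geodesic property and the Ricci curvature of xi *)

Section KappaMu.
Variables (R : realType) (M : topologicalType) (m : nat).
Variable A : smooth_manifold R M m.
Variables (phi : matrix_family A) (xi : vector_family A).
Variables (eta : covector_family A) (g : matrix_family A).
Variable nabla : vector_family A -> vector_family A -> vector_family A.
Implicit Types (i : chart A) (p : M) (u v : 'rV[R]_m).

(** Cartan's formula for d eta (X, Y), equated to zero. *)
Lemma closed1_bracket (X Y : vector_family A) i p :
  one_form eta -> closed1 eta -> vector_field X -> vector_field Y -> dom i p ->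
  chart_deriv i (fun q => pair1 eta i q (Y i q)) p (X i p)
  - chart_deriv i (fun q => pair1 eta i q (X i q)) p (Y i p)
  = pair1 eta i p (bracket X Y i p).
Proof.
move=> [se _] deta [sX _] [sY _] ip.
have := deta i p ip (X i p) (Y i p).
rewrite !chart_deriv_pair1_cst // !chart_deriv_pair1 // => dXY.
have -> : pair1 eta i p (bracket X Y i p) =
    pair1 eta i p (chart_deriv i (Y i) p (X i p))
    - pair1 eta i p (chart_deriv i (X i) p (Y i p)).
  rewrite /pair1 /bracket mulmxBl [LHS]mxE; congr (_ + _).
  by rewrite [LHS]mxE.
lra.
Qed.

(** Closedness of eta, applied to xi and W = nabla xi xi, gives
    xi (eta W) = eta [xi, W]; expanding both sides with the connection leaves
    g (W, W) = g (xi, nabla W xi), and the latter is W (g (xi, xi)) / 2 = 0. *)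
Lemma unit_closed_reeb_geodesic :
  almost_contact_metric phi xi eta g -> closed1 eta -> levi_civita g nabla ->
  geodesic_field nabla xi.
Proof.
move=> acm deta lc i p ip.
have fxi := acm_xi acm; have feta := acm_eta acm.
set W := nabla xi xi.
have fW : vector_field W := nabla_field (lc_connection lc) fxi fxi.
have [_ gsym gpos] := acm_metric acm.
apply/eqP; apply: contraT => /(gpos i p ip); rewrite -/W.
suff -> : pair2 g i p (W i p) (W i p) = 0 by rewrite ltxx.
have gWxi := lc_metric lc fxi fxi fW ip.
have gxixi := lc_metric lc fW fxi fxi ip.
have torsion := lc_torsion_free lc fxi fW ip.
have closed := closed1_bracket feta deta fxi fW ip.
have unitE : chart_deriv i (fun q => pair2 g i q (xi i q) (xi i q)) p (W i p) = 0.
  rewrite (chart_deriv_local (h := fun=> (1 : R^o)) _ ip) ?chart_deriv_cst // => q iq.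
  exact: (acm_xi_unit acm).
have etaxiE : chart_deriv i (fun q => pair1 eta i q (xi i q)) p (W i p) = 0.
  rewrite (chart_deriv_local (h := fun=> (1 : R^o)) _ ip) ?chart_deriv_cst // => q iq.
  exact: (acm_eta_xi acm).
have etaWE : chart_deriv i (fun q => pair1 eta i q (W i q)) p (xi i p)
    = chart_deriv i (fun q => pair2 g i q (xi i q) (W i q)) p (xi i p).
  apply: chart_deriv_local => // q iq.
  by rewrite gsym // (metric_xi acm).
have torsionE : pair1 eta i p (bracket xi W i p) =
    pair2 g i p (xi i p) (nabla xi W i p) - pair2 g i p (xi i p) (nabla W xi i p).
  rewrite -torsion -(metric_xi acm) // gsym // /pair2 linearB /= mulmxBr.
  by rewrite [LHS]mxE; congr (_ + _); rewrite [LHS]mxE.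
have symE := gsym i p ip (nabla W xi i p) (xi i p).
rewrite -/W in gWxi.
lra.
Qed.

(** The trace of kappa (I - eta (x) xi) + mu h: the projection along xi has rank
    m - 1, and h is traceless. *)
Lemma ricci_xi_xi (kappa mu : R) (S : matrix_family A) i p :
  kappa_mu_almost_cokahler kappa mu phi xi eta g nabla ->
  ricci_tensor nabla S -> dom i p ->
  pair2 S i p (xi i p) (xi i p) = kappa * (m%:R - 1).
Proof.
move=> km [_ ricci] ip.
have acm := ack_contact (km_cokahler km); have fxi := acm_xi acm.
pose B := kappa *: (1%:M - eta i p *m xi i p) + mu *: h_matrix phi xi i p.
rewrite (ricci xi xi fxi fxi i p ip B) => [|X fX].
  rewrite /B linearD linearZ linearB /= mxtrace1 mxtrace_mulC linearZ /=.
  rewrite (mxtrace_h acm) // mulr0 addr0 /mxtrace big_ord1.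
  by have := acm_eta_xi acm ip; rewrite /pair1 => ->.
rewrite (km_curvature km fX fxi ip) (acm_eta_xi acm ip) !scale1r.
rewrite (h_operatorE acm fX ip) (h_operatorE acm fxi ip) (h_matrix_xi acm ip).
rewrite scaler0 subr0 /B; move: (h_matrix phi xi i p) => H.
rewrite mulmxDr -!scalemxAr mulmxBr mulmx1 mulmxA.
by rewrite [X i p *m eta i p]mx11_scalar mul_scalar_mx.
Qed.

(** At (xi, xi) the Lie derivative of g along xi vanishes, because g (xi, xi) is
    constant and [xi, xi] = 0. *)
Lemma soliton_lambda (beta lambda : M -> R) (S : matrix_family A) i p :
  almost_contact_metric phi xi eta g ->
  beta_almost_ricci_soliton beta lambda xi g S -> dom i p ->
  lambda p = - pair2 S i p (xi i p) (xi i p).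
Proof.
move=> acm sol ip; have fxi := acm_xi acm.
have := sol xi xi fxi fxi i p ip; rewrite (acm_xi_unit acm ip).
have -> : lie02 xi g xi xi i p = 0.
  rewrite /lie02 (chart_deriv_local (h := fun=> (1 : R^o)) _ ip); last first.
    by move=> q iq; exact: (acm_xi_unit acm).
  rewrite chart_deriv_cst /bracket subrr /pair2 !mul0mx trmx0 mulmx0.
  by rewrite mxE !subr0.
lra.
Qed.

End KappaMu.

Theorem theorem4p1 (R : realType) (n : nat) (hn : (0 < n)%N)
  (M : topologicalType) (A : smooth_manifold R M (2 * n + 1))
  (phi : matrix_family A) (xi : vector_family A) (eta : covector_family A)
  (g : matrix_family A)
  (nabla : vector_family A -> vector_family A -> vector_family A)
  (kappa mu : R)
  (hM : kappa_mu_almost_cokahler kappa mu phi xi eta g nabla)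
  (S : matrix_family A) (hS : ricci_tensor nabla S)
  (beta lambda : M -> R)
  (hsoliton : beta_almost_ricci_soliton beta lambda xi g S)
  (hbeta : (forall p, 0 < beta p) \/ (forall p, beta p < 0)) :
  geodesic_field nabla xi /\
  [/\ kappa < 0 -> expanding lambda,
      kappa = 0 -> steady lambda
    & 0 < kappa -> shrinking lambda].
Proof.
have ack := km_cokahler hM; have acm := ack_contact ack.
split.
  exact: unit_closed_reeb_geodesic acm (ack_eta_closed ack) (km_levi_civita hM).
have lambdaE p : lambda p = - (kappa * (2 * n)%:R).
  have [i ip] := dom_cover A p.
  rewrite (soliton_lambda acm hsoliton ip) (ricci_xi_xi hM hS ip).
  by rewrite natrD addrK.
have n_gt0 : 0 < (2 * n)%:R :> R by rewrite ltr0n muln_gt0.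
split=> [k0|k0|k0] p; rewrite lambdaE.
- by rewrite oppr_gt0 pmulr_llt0.
- by rewrite k0 mul0r oppr0.
- by rewrite oppr_lt0 mulr_gt0.
Qed.
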